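(* For any formula $\phi_0$ of $\mathcal L$: (1) if $\nvdash_\Re\phi_0$, then there is a world $w$ of some Kripke model $\langle W,\rightarrow,\Vdash\rangle$ such that $w\nVdash\phi_0$; (2) if $\nvdash_{\Re_d}\phi_0$, then there is a world $w$ of some deterministic Kripke model $\langle W,\rightarrow,\Vdash\rangle$ such that $w\nVdash\phi_0$.
   Context: The language $\mathcal L$: formulas built from propositional variables and $\bot$ using $\rightarrow$ and a binary modality $\rhd$; $\wedge,\vee,\neg,\top$ defined as usual. The logic $\Re$: classical propositional logic in $\mathcal L$ plus axioms A1: $\phi\rhd\psi\rightarrow(\chi\rhd\psi\rightarrow(\phi\vee\chi)\rhd\psi)$, A2: $\bot\rhd\phi$, A3: $\phi\rhd\top$, with rules Modus Ponens and M: from $\phi_1\rightarrow\phi_2$ and $\psi_1\rightarrow\psi_2$ infer $\phi_2\rhd\psi_1\rightarrow\phi_1\rhd\psi_2$. The logic $\Re_d$ is $\Re$ plus axiom A4: $\phi\rhd\psi\rightarrow(\phi\rhd\chi\rightarrow\phi\rhd(\psi\wedge\chi))$. A Kripke model is a triple $\langle W,\rightarrow,\Vdash\rangle$ where $W$ is a finite set of worlds, $\rightarrow$ is a ternary relation on $W$ written $u\rightarrow_w v$, and $\Vdash$ is a relation between worlds and propositional variables, extended to all formulas by: $w\nVdash\bot$; $w\Vdash\phi\rightarrow\psi$ iff $w\nVdash\phi$ or $w\Vdash\psi$; $w\Vdash\phi\rhd\psi$ iff for all worlds $u,v$ with $u\rightarrow_w v$ and $u\Vdash\phi$ there is a world $v'$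 with $u\rightarrow_w v'$ and $v'\Vdash\psi$. A Kripke model is deterministic if for all $w,u\in W$ there is at most one $v\in W$ with $u\rightarrow_w v$. *)

(* Defs.v *)
From mathcomp Require Import all_boot.

Set Implicit Arguments.
Unset Strict Implicit.
Unset Printing Implicit Defensive.

Declare Scope rhd_scope.
Delimit Scope rhd_scope with rhd.

Section Language.
Variable V : Type.

Inductive formula : Type :=
| Var of V
| Bot
| Imp of formula & formula
| Rhd of formula & formula.

Definition Neg (p : formula) : formula := Imp p Bot.
Definition Top : formula := Neg Bot.
Definition Or (p q : formula) : formula := Imp (Neg p) q.
Definition And (p q : formula) : formula := Neg (Imp p (Neg q)).

End Language.

Arguments Bot {V}.
Arguments Top {V}.
Bind Scope rhd_scope with formula.

Notation "⊥" := Bot (at level 0) : rhd_scope.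
Notation "⊤" := Top (at level 0) : rhd_scope.
Notation "p ⊃ q" := (Imp p q) (at level 55, right associativity) : rhd_scope.
Notation "p ▷ q" := (Rhd p q) (at level 53, no associativity) : rhd_scope.
Notation "¬ p" := (Neg p) (at level 35, right associativity) : rhd_scope.
Notation "p ∨ q" := (Or p q) (at level 50, left associativity) : rhd_scope.
Notation "p ∧ q" := (And p q) (at level 40, left associativity) : rhd_scope.

Section Logics.
Variable V : Type.
Local Open Scope rhd_scope.

(* A Hilbert axiomatization of classical propositional logic over the
   primitive connectives (modus ponens is a rule of [derivable]). *)
Inductive classical_axiom : formula V -> Prop :=
| ax_K p q : classical_axiom (p ⊃ q ⊃ p)
| ax_S p q r : classical_axiom ((p ⊃ q ⊃ r) ⊃ (p ⊃ q) ⊃ p ⊃ r)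
| ax_DN p : classical_axiom (¬ ¬ p ⊃ p).

Inductive Re_axiom : formula V -> Prop :=
| Re_classical p : classical_axiom p -> Re_axiom p
| ax_A1 p q r : Re_axiom (p ▷ q ⊃ r ▷ q ⊃ (p ∨ r) ▷ q)
| ax_A2 p : Re_axiom (⊥ ▷ p)
| ax_A3 p : Re_axiom (p ▷ ⊤).

Inductive Red_axiom : formula V -> Prop :=
| Red_Re p : Re_axiom p -> Red_axiom p
| ax_A4 p q r : Red_axiom (p ▷ q ⊃ p ▷ r ⊃ p ▷ (q ∧ r)).

Inductive derivable (Ax : formula V -> Prop) : formula V -> Prop :=
| der_ax p : Ax p -> derivable Ax p
| der_MP p q : derivable Ax (p ⊃ q) -> derivable Ax p -> derivable Ax q
| der_M p1 p2 q1 q2 :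
    derivable Ax (p1 ⊃ p2) -> derivable Ax (q1 ⊃ q2) ->
    derivable Ax (p2 ▷ q1 ⊃ p1 ▷ q2).

Definition Re_derivable : formula V -> Prop := derivable Re_axiom.
Definition Red_derivable : formula V -> Prop := derivable Red_axiom.

End Logics.

(* [step w u v] is u →_w v. *)
Record kripke_model (V : Type) := KripkeModel {
  world : finType;
  step : world -> world -> world -> Prop;
  holds : world -> V -> Prop
}.

Fixpoint forces (V : Type) (M : kripke_model V) (w : world M) (p : formula V)
    {struct p} : Prop :=
  match p with
  | Var x => holds w x
  | Bot => False
  | Imp p1 p2 => ~ forces w p1 \/ forces w p2
  | Rhd p1 p2 =>
      forall u v : world M, step w u v -> forces u p1 ->
        exists v' : world M, step w u v' /\ forces v' p2
  end.

Definition deterministic (V : Type) (M : kripke_model V) : Prop :=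
  forall w u v v' : world M, step w u v -> step w u v' -> v = v'.

(* Main.v *)
From Stdlib Require Import List.
Require Import Defs.
From mathcomp Require Import all_boot.
From mathcomp Require Import boolp.

(** Worlds are pairs of an atom (a consistent choice of signs for the
    subformulas of [phi0]) and a set [L] of atoms; the label [L] is the set of
    successors that the world has relative to every [w] that allows it.  Labels
    are needed because refuting different [p ▷ q] at [w] may require the same
    atom to have different successors.

    If [w] does not prove [p ▷ q], the formulas [r] such that [w] proves [r ▷ q]
    form an ideal by A1, A2 and M, so some atom [u] containing [p] avoids it.
    In [Re], label [u] with all atoms refuting [q].  In [Re_d], A4 makes the
    formulas [r] such that [w] proves [u ▷ r] a filter, which extends to a single
    atom refuting [q], so labels with at most one element suffice. *)

Set Implicit Arguments.
Unset Strict Implicit.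
Unset Printing Implicit Defensive.

Local Open Scope rhd_scope.

(** * Classical propositional reasoning from hypotheses *)

Section Propositional.
Variables (V : Type) (Ax : formula V -> Prop).
Variable ReAx : forall p, Re_axiom p -> Ax p.
Implicit Types (p q r : formula V) (G : seq (formula V)).

(* Hypotheses are discharged from the head, so that the deduction theorem holds
   by conversion. *)
Fixpoint entails G p : Prop :=
  if G is q :: G' then entails G' (q ⊃ p) else derivable Ax p.

Lemma classical_derivable p : classical_axiom p -> derivable Ax p.
Proof. by move=> ?; apply/der_ax/ReAx/Re_classical. Qed.

Lemma entails_weaken G p : derivable Ax p -> entails G p.
Proof.
elim: G p => //= q G IH p dp; apply: IH.
exact: der_MP (classical_derivable (ax_K p q)) dp.
Qed.

Lemma entails_MP G p q : entails G (p ⊃ q) -> entails G p -> entails G q.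
Proof.
elim: G p q => [|r G IH] p q /=; first exact: der_MP.
move=> pq; apply: (IH); apply: (IH) pq.
exact/entails_weaken/classical_derivable/ax_S.
Qed.

Lemma entails_cons G p q : entails G p -> entails (q :: G) p.
Proof.
by apply: entails_MP; apply/entails_weaken/classical_derivable/ax_K.
Qed.

Lemma entails_head G p : entails (p :: G) p.
Proof.
have dK q : entails G (p ⊃ q ⊃ p).
  exact/entails_weaken/classical_derivable/ax_K.
apply: entails_MP (dK p); apply: entails_MP (dK (p ⊃ p)).
exact/entails_weaken/classical_derivable/ax_S.
Qed.

Lemma entails_In G p : In p G -> entails G p.
Proof.
elim: G => //= q G IH [->|/IH]; [exact: entails_head | exact: entails_cons].
Qed.

Lemma entails_contra G p : entails (¬ p :: G) ⊥ -> entails G p.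
Proof.
apply: (@entails_MP G (¬ ¬ p)).
exact/entails_weaken/classical_derivable/ax_DN.
Qed.

Lemma entails_exfalso G p : entails G ⊥ -> entails G p.
Proof. by move=> ?; apply/entails_contra/entails_cons. Qed.

Lemma entails_andI G p q : entails G p -> entails G q -> entails G (p ∧ q).
Proof.
move=> dp dq; change (entails (p ⊃ ¬ q :: G) ⊥).
apply: (@entails_MP _ q); last exact: entails_cons.
by apply: (entails_MP (entails_head _ _)); apply: entails_cons.
Qed.

Lemma entails_andl G p q : entails G (p ∧ q) -> entails G p.
Proof.
move=> dpq; apply: entails_contra.
apply: entails_MP (entails_cons _ dpq) _.
change (entails (q :: p :: ¬ p :: G) ⊥).
by apply: (@entails_MP _ p); apply: entails_In; rewrite /=; tauto.
Qed.

Lemma entails_andr G p q : entails G (p ∧ q) -> entails G q.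
Proof.
move=> dpq; apply: entails_contra.
apply: entails_MP (entails_cons _ dpq) _.
change (entails (q :: p :: ¬ q :: G) ⊥).
by apply: (@entails_MP _ q); apply: entails_In; rewrite /=; tauto.
Qed.

(** Assume [¬ r]: the first case then refutes [p], the disjunction, which unfolds to [¬ p ⊃ q],
    yields [q], and the second case yields [r]. *)
Lemma entails_orE G p q r :
  entails G (p ∨ q) -> entails (p :: G) r -> entails (q :: G) r ->
  entails G r.
Proof.
move=> dpq dpr dqr; apply: entails_contra.
apply: (@entails_MP _ r); first exact: entails_head.
apply: (@entails_MP _ q); first exact: (@entails_cons G (q ⊃ r)).
apply: (@entails_MP _ (¬ p)); first exact: entails_cons.
change (entails (p :: ¬ r :: G) ⊥).
apply: (@entails_MP _ r); first by apply: entails_In; right; left.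
apply: (@entails_MP _ p); last exact: entails_head.
exact/entails_cons/(@entails_cons G (p ⊃ r)).
Qed.

Lemma derivable_trans p q r :
  derivable Ax (p ⊃ q) -> derivable Ax (q ⊃ r) -> derivable Ax (p ⊃ r).
Proof.
by move=> pq qr; apply: (@entails_MP [:: p] q) => //; apply: entails_weaken.
Qed.

Lemma entails_Rhd G p1 p2 q1 q2 :
  derivable Ax (p1 ⊃ p2) -> derivable Ax (q1 ⊃ q2) ->
  entails G (p2 ▷ q1) -> entails G (p1 ▷ q2).
Proof.
by move=> p12 q12; apply: entails_MP; apply/entails_weaken/der_M.
Qed.

(** * Ideals of the Lindenbaum algebra and conjunctions of literals *)

Definition ideal (I : formula V -> Prop) : Prop :=
  [/\ I ⊥, forall p q, derivable Ax (p ⊃ q) -> I q -> I p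
    & forall p q, I p -> I q -> I (p ∨ q)].

Lemma ideal_below r : ideal (fun p => derivable Ax (p ⊃ r)).
Proof.
split=> [|p q|p q pr qr].
- exact/(@entails_exfalso [:: ⊥])/entails_head.
- exact: derivable_trans.
- apply: (@entails_orE [:: p ∨ q] p q); first exact: entails_head.
    exact: (@entails_weaken [:: p ∨ q] (p ⊃ r)).
  exact: (@entails_weaken [:: p ∨ q] (q ⊃ r)).
Qed.

Definition literal (b : bool) p : formula V := if b then p else ¬ p.

Fixpoint conj_literals (Phi : seq (formula V)) (s : seq bool) : formula V :=
  match Phi, s with
  | p :: Phi', b :: s' => literal b p ∧ conj_literals Phi' s'
  | _, _ => ⊤
  end.

Lemma conj_literals_decides Phi (s : (size Phi).-tuple bool) p :
  In p Phi -> derivable Ax (conj_literals Phi s ⊃ p) \/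
              derivable Ax (conj_literals Phi s ⊃ ¬ p).
Proof.
case: s => s /= /eqP; elim: Phi s => //= q Phi IH [|b s] //= [] /IH{}IH.
have h := entails_head [::] (literal b q ∧ conj_literals Phi s).
case=> [<-|/IH].
  have := @entails_andl [:: _] _ _ h.
  by case: b {h}; [left | right].
have H := @entails_andr [:: _] _ _ h.
by case=> ?; [left | right]; apply: derivable_trans H _.
Qed.

(** Signs are chosen one formula at a time: [p] implies [(p ∧ q) ∨ (p ∧ ¬ q)], so an ideal that
    misses [p] misses one of the disjuncts. *)
Lemma ideal_extension (I : formula V -> Prop) Phi p :
  ideal I -> ~ I p ->
  exists s : (size Phi).-tuple bool, ~ I (p ∧ conj_literals Phi s).
Proof.
case=> _ Idown Ior; elim: Phi p => [|q Phi IH] p nIp /=.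
  exists [tuple] => /= /Idown-/(_ p) H; apply/nIp/H.
  apply: (@entails_andI [:: p]); first exact: entails_head.
  exact/(@entails_weaken [:: p])/(entails_head [::]).
have [b nIpb] : exists b, ~ I (p ∧ literal b q).
  apply: contrapT => /forallNP nI.
  have /contrapT Ip1 := nI true; have /contrapT Ip0 := nI false.
  apply: nIp; apply: Idown (Ior _ _ Ip1 Ip0) => /=.
  change (entails [:: ¬ (p ∧ q); p] (p ∧ ¬ q)).
  apply: entails_andI; first by apply: entails_In; right; left.
  change (entails [:: q; ¬ (p ∧ q); p] ⊥).
  apply: (@entails_MP _ (p ∧ q)); first by apply: entails_In; right; left.
  by apply: entails_andI; apply: entails_In; rewrite /=; tauto.
have [s nIs] := IH _ nIpb; exists [tuple of b :: s] => /= Is.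
apply/nIs/Idown/Is; set c := conj_literals _ _.
have h := entails_head [::] ((p ∧ literal b q) ∧ c).
have hl := @entails_andl [:: _] _ _ h.
apply: (@entails_andI [:: _]); first exact: (@entails_andl [:: _] _ _ hl).
apply: (@entails_andI [:: _]); first exact: (@entails_andr [:: _] _ _ hl).
exact: (@entails_andr [:: _] _ _ h).
Qed.

End Propositional.

(** * Atoms over a finite list of formulas *)

Section Completeness.
Variables (V : Type) (Ax : formula V -> Prop) (Phi : seq (formula V)).
Variable ReAx : forall p, Re_axiom p -> Ax p.
Implicit Types p q r : formula V.

(** Sign vectors, unlike sets of formulas, form a [finType] for an arbitrary [V]. *)
Definition atom : finType :=
  {s : (size Phi).-tuple bool |
    ~~ `[< derivable Ax (conj_literals Phi s ⊃ ⊥) >]}.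

Definition char (u : atom) : formula V := conj_literals Phi (val u).

Lemma char_consistent u : ~ derivable Ax (char u ⊃ ⊥).
Proof. by have /asboolPn := valP u. Qed.

Lemma char_decides u p : In p Phi -> ~ derivable Ax (char u ⊃ p) ->
  derivable Ax (char u ⊃ ¬ p).
Proof. by move/(conj_literals_decides ReAx (val u)); case. Qed.

Lemma char_Imp u p q : In p Phi ->
  derivable Ax (char u ⊃ p ⊃ q) <->
  ~ derivable Ax (char u ⊃ p) \/ derivable Ax (char u ⊃ q).
Proof.
move=> Pp; split=> [upq|[|uq]].
- case: (EM (derivable Ax (char u ⊃ p))) => [up|]; last by left.
  by right; apply: (@entails_MP _ _ ReAx [:: char u] p).
- move=> /(char_decides Pp) unp; apply: (@entails_exfalso _ _ ReAx [:: p; _]).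
  apply: (@entails_MP _ _ ReAx _ p); last exact: entails_head.
  exact: (@entails_cons _ _ ReAx [:: _] (¬ p)).
- exact: (@entails_cons _ _ ReAx [:: char u]).
Qed.

(** The sign vector that avoids [I] is consistent, since otherwise its conjunction with [p] would
    lie below [⊥]. *)
Lemma ideal_atom (I : formula V -> Prop) p :
  ideal Ax I -> ~ I p -> exists u : atom, ~ I (p ∧ char u).
Proof.
move=> idI /(ideal_extension ReAx Phi idI)[s nIs]; case: idI => I0 Idown _.
have cs : ~~ `[< derivable Ax (conj_literals Phi s ⊃ ⊥) >].
  apply/asboolPn => ds; apply/nIs/Idown/I0.
  apply: derivable_trans (ds) => //.
  exact: (@entails_andr _ _ ReAx [:: _] p) (entails_head _ _ _).
by exists (Sub s cs).
Qed.

(** The atom decides [p]; deciding it negatively would put [p ∧ char u] below [⊥], hence in [I]. *)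
Lemma ideal_atom_In (I : formula V -> Prop) p :
  ideal Ax I -> In p Phi -> ~ I p ->
  exists u : atom, derivable Ax (char u ⊃ p) /\ ~ I (char u).
Proof.
move=> idI Pp /(ideal_atom idI)[u nIu]; exists u; case: idI => I0 Idown _.
have pu := entails_head ReAx [::] (p ∧ char u).
have pul := @entails_andl _ _ ReAx [:: _] _ _ pu.
have pur := @entails_andr _ _ ReAx [:: _] _ _ pu.
split; last by move=> /(Idown _ _ pur).
apply: contrapT => /(char_decides Pp) unp; apply/nIu/Idown/I0.
by apply: (@entails_MP _ _ ReAx [:: _] p) => //; apply: derivable_trans unp.
Qed.

Lemma ideal_atom_Top (I : formula V -> Prop) :
  ideal Ax I -> ~ I ⊤ -> exists u : atom, ~ I (char u).
Proof.
move=> idI /(ideal_atom idI)[u nIu]; exists u; case: idI => _ Idown _.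
move=> Iu; apply/nIu/Idown/Iu.
exact: (@entails_andr _ _ ReAx [:: _] ⊤) (entails_head _ _ _).
Qed.

Lemma atom_between p q : In p Phi -> ~ derivable Ax (p ⊃ q) ->
  exists u : atom, derivable Ax (char u ⊃ p) /\ ~ derivable Ax (char u ⊃ q).
Proof. exact: ideal_atom_In (ideal_below ReAx q). Qed.

(** * Ideals from the modality, and labels refuting a formula *)

Lemma ideal_Rhd r q : ideal Ax (fun p => derivable Ax (r ⊃ p ▷ q)).
Proof.
split=> [|p1 p2 p12|p1 p2 p1q p2q].
- exact/(@entails_weaken _ _ ReAx [:: r])/der_ax/ReAx/ax_A2.
- apply: (@entails_Rhd _ _ ReAx [:: r]) => //.
  exact: (@entails_head _ _ ReAx [::]).
- apply: (@entails_MP _ _ ReAx [:: r]) p2q.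
  apply: (@entails_MP _ _ ReAx [:: r]) p1q.
  exact/(@entails_weaken _ _ ReAx [:: r])/der_ax/ReAx/ax_A1.
Qed.

Lemma entails_Rhd_theorem r p q :
  derivable Ax q -> derivable Ax (r ⊃ p ▷ q).
Proof.
move=> dq; apply: (@entails_Rhd _ _ ReAx [:: r] p p ⊤).
- exact: (@entails_head _ _ ReAx [::]).
- exact: (@entails_weaken _ _ ReAx [:: ⊤]).
- exact/(@entails_weaken _ _ ReAx [:: r])/der_ax/ReAx/ax_A3.
Qed.

(** This is what the formulas [char u ▷ q] proved by [w] demand of the successors [L] of [u]. *)
Definition allows (w u : atom) (L : {set atom}) : Prop :=
  forall q, In q Phi -> derivable Ax (char w ⊃ char u ▷ q) ->
    exists2 v, v \in L & derivable Ax (char v ⊃ q).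

(** Nonemptiness matters because [p ▷ q] constrains only those [u] that have a successor. *)
Definition refuter (q : formula V) (w u : atom) (L : {set atom}) : Prop :=
  [/\ allows w u L, exists v, v \in L
    & forall v, v \in L -> ~ derivable Ax (char v ⊃ q)].

(** If [w] proves [char u ▷ r], then by M [r ⊃ q] is not derivable, so some atom proves [r] but not
    [q]. If every atom proved [q], it would be a theorem and A3 would give [char u ▷ q]. *)
Lemma refuter_exists q w u : ~ derivable Ax (char w ⊃ char u ▷ q) ->
  exists L, refuter q w u L.
Proof.
move=> nwq; exists [set v | ~~ `[< derivable Ax (char v ⊃ q) >]].
split=> [r Pr wr||v].
- have [|v [vr vq]] := @atom_between r q Pr.
    move=> rq; apply: nwq; apply: (@entails_Rhd _ _ ReAx [:: _]) rq wr.
    exact: (@entails_head _ _ ReAx [::]).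
  by exists v => //; rewrite inE; apply/asboolPn.
- have [|v vq] := @ideal_atom_Top _ (ideal_below ReAx q).
    move=> Tq; apply/nwq/entails_Rhd_theorem/(der_MP Tq).
    exact: (@entails_head _ _ ReAx [::]).
  by exists v; rewrite inE; apply/asboolPn.
- by rewrite inE => /asboolPn.
Qed.

(** The filter of formulas [t] such that [r] proves [p ▷ t] appears dually, through [t = s ⊃ q]. By
    A4 it contains [(s1 ⊃ q) ∧ (s2 ⊃ q)], which implies [(s1 ∨ s2) ⊃ q]. *)
Lemma ideal_Rhd_Imp r p q (RedAx : forall p, Red_axiom p -> Ax p) :
  ideal Ax (fun s => derivable Ax (r ⊃ p ▷ (s ⊃ q))).
Proof.
have pp := @entails_head _ _ ReAx [::] p.
split=> [|s1 s2 s12|s1 s2 ws1 ws2].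
- apply: entails_Rhd_theorem; apply: (@entails_exfalso _ _ ReAx [:: ⊥]).
  exact: (@entails_head _ _ ReAx [::]).
- apply: (@entails_Rhd _ _ ReAx [:: r]) => //.
  apply: (@entails_MP _ _ ReAx [:: s1; s2 ⊃ q] s2).
    by apply: entails_In => //; right; left.
  exact: (@entails_weaken _ _ ReAx [:: s2 ⊃ q]) s12.
- apply: (@entails_Rhd _ _ ReAx [:: r] p p ((s1 ⊃ q) ∧ (s2 ⊃ q))) => //.
    have h := entails_head ReAx [::] ((s1 ⊃ q) ∧ (s2 ⊃ q)).
    apply: (@entails_orE _ _ ReAx [:: s1 ∨ s2; (s1 ⊃ q) ∧ (s2 ⊃ q)] s1 s2).
    + exact: entails_head.
    + apply: (@entails_cons _ _ ReAx [:: _] (s1 ⊃ q)).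
      exact: (@entails_andl _ _ ReAx [:: _] _ _ h).
    + apply: (@entails_cons _ _ ReAx [:: _] (s2 ⊃ q)).
      exact: (@entails_andr _ _ ReAx [:: _] _ _ h).
  apply: (@entails_MP _ _ ReAx [:: r]) ws2.
  apply: (@entails_MP _ _ ReAx [:: r]) ws1.
  exact/(@entails_weaken _ _ ReAx [:: r])/der_ax/RedAx/ax_A4.
Qed.

Lemma refuter_singleton (RedAx : forall p, Red_axiom p -> Ax p) q w u :
  ~ derivable Ax (char w ⊃ char u ▷ q) -> exists v, refuter q w u [set v].
Proof.
move=> nwq; have uu := @entails_head _ _ ReAx [::] (char u).
(* The ideal misses [⊤] because [⊤ ⊃ q] implies [q]; an atom outside it becomes the only
   successor. *)
have [|v nv] := ideal_atom_Top (ideal_Rhd_Imp (char w) (char u) q RedAx).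
  move=> wTq; apply/nwq; apply: (@entails_Rhd _ _ ReAx [:: _]) wTq => //.
  apply: (@entails_MP _ _ ReAx [:: ⊤ ⊃ q]); first exact: entails_head.
  exact/(@entails_weaken _ _ ReAx [:: _])/(@entails_head _ _ ReAx [::]).
exists v; split=> [r Pr wr||_ /set1P->].
- exists v; rewrite ?set11 //.
  (* If [v] proved [¬ r], then [r] would imply [char v ⊃ q], and M would put [char v] in the
     ideal. *)
  apply: contrapT => /(char_decides Pr) vnr; apply: nv.
  apply: (@entails_Rhd _ _ ReAx [:: _]) wr => //.
  apply: (@entails_exfalso _ _ ReAx [:: char v; r]).
  apply: (@entails_MP _ _ ReAx _ r); last by apply: entails_In => //; right; left.
  exact: (@entails_weaken _ _ ReAx [:: r] (char v ⊃ ¬ r)).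
- by exists v; rewrite set11.
- by move=> vq; apply/nv/entails_Rhd_theorem.
Qed.

(** * The canonical model and the truth lemma *)

Variable S : {set atom} -> Prop.

Definition canonical_model : kripke_model V :=
  @KripkeModel V (atom * {set atom})%type
    (fun w u v => [/\ S u.2, allows w.1 u.1 u.2, v.1 \in u.2 & v.2 = set0])
    (fun w x => derivable Ax (char w.1 ⊃ Var x)).

Fixpoint subformulas p : seq (formula V) :=
  p :: match p with
       | Imp p1 p2 | Rhd p1 p2 => app (subformulas p1) (subformulas p2)
       | _ => [::]
       end.

Lemma incl_subformulas p q r :
  incl (r :: app (subformulas p) (subformulas q)) Phi ->
  incl (subformulas p) Phi /\ incl (subformulas q) Phi.
Proof. by move=> s; apply: incl_app_inv; apply: (proj2 (incl_cons_inv s)). Qed.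

Lemma subformulas_self p : incl (subformulas p) Phi -> In p Phi.
Proof. by apply; case: p => *; left. Qed.

Lemma truth_lemma (hS : forall q w u, ~ derivable Ax (char w ⊃ char u ▷ q) ->
    exists2 L, S L & refuter q w u L) p (w : world canonical_model) :
  incl (subformulas p) Phi -> forces w p <-> derivable Ax (char w.1 ⊃ p).
Proof.
elim: p w => [x||p IHp q IHq|p IHp q IHq] w //=.
- by split=> // /char_consistent.
- move=> s; have [sp sq] := incl_subformulas s.
  rewrite (IHp w sp) (IHq w sq); apply: iff_sym.
  exact/(char_Imp _ _ (subformulas_self sp)).
- move=> s; have [sp sq] := incl_subformulas s.
  have [Pp Pq] := (subformulas_self sp, subformulas_self sq).
  split=> [wpq|wpq u v [Su wu _ _] /(IHp _ sp) up]; last first.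
    (* M turns [p ▷ q] into [char u.1 ▷ q], so the allowed label of [u] contains an atom proving
       [q]. *)
    have [|v' v'L v'q] := wu q Pq.
      apply: (@entails_Rhd _ _ ReAx [:: _]) up _ wpq.
      exact: (@entails_head _ _ ReAx [::]).
    by exists (v', set0); split; last exact/(IHq (v', set0) sq).
  (* An atom [u] proving [p] avoids the ideal of all [r] such that [w] proves [r ▷ q]. With a
     refuting label [L], the world [(u, L)] has a successor, and none of its successors proves
     [q]. *)
  apply: contrapT => nwpq.
  have [u [up /hS[L SL [wuL [v vL] nLq]]]] :=
    ideal_atom_In (ideal_Rhd (char w.1) q) Pp nwpq.
  have [||[v' L'] [[_ _ v'L _] /(IHq _ sq) v'q]] := wpq (u, L) (v, set0).
  + by split.
  + exact/(IHp (u, L) sp).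
  + exact: nLq v'L v'q.
Qed.

End Completeness.

(** * Countermodels for both logics *)

Lemma canonical_countermodel (V : Type) (Ax : formula V -> Prop) p
    (Phi := subformulas p) (S : {set atom Ax Phi} -> Prop) :
  (forall r, Re_axiom r -> Ax r) ->
  (forall q (w u : atom Ax Phi), ~ derivable Ax (char w ⊃ char u ▷ q) ->
    exists2 L, S L & refuter q w u L) ->
  ~ derivable Ax p -> exists w : world (canonical_model S), ~ forces w p.
Proof.
move=> ReAx hS np.
(* The ideal below an underivable [p] misses [⊤], so some atom does not prove [p]. *)
have [|w nwp] := @ideal_atom_Top _ _ Phi ReAx _ (ideal_below ReAx p).
  by move=> Tp; apply/np/(der_MP Tp)/(@entails_head _ _ ReAx [::]).
by exists (w, set0) => /(truth_lemma ReAx hS (w, set0) (@incl_refl _ Phi)).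
Qed.

Theorem theorem3 (V : Type) (phi0 : formula V) :
  (~ Re_derivable phi0 ->
     exists (M : kripke_model V) (w : world M), ~ forces w phi0) /\
  (~ Red_derivable phi0 ->
     exists (M : kripke_model V) (w : world M),
       deterministic M /\ ~ forces w phi0).
Proof.
split=> nphi0.
  pose S (L : {set atom (@Re_axiom V) (subformulas phi0)}) := True.
  have [|w nw] := canonical_countermodel (S := S) (fun _ => id) _ nphi0.
    by move=> q w u /refuter_exists[] // L ?; exists L.
  by exists (canonical_model S), w.
pose S (L : {set atom (@Red_axiom V) (subformulas phi0)}) :=
  exists v, L = [set v].
have RedRe := @Red_Re V.
have [|w nw] := canonical_countermodel (S := S) RedRe _ nphi0.
  move=> q w u /(refuter_singleton RedRe)[] // v ?.
  by exists [set v] => //; exists v.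
exists (canonical_model S), w; split=> // w' [u L] [v1 L1] [v2 L2] /=.
(* Both successors are the unique element of [L] paired with [set0]. *)
by move=> [[v ->] _ /set1P/= -> ->] [_ _ /set1P/= -> ->].
Qed.
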